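(* Let $L$ be a lattice. Then the following are equivalent: (i) $L$ embeds (as a lattice) into a lattice of the form $\mathbf{Co}(P)$, for some poset $P$; (ii) $L$ satisfies the identities (S), (U), and (B); (iii) there exists a poset $R$ such that $L$ has a lattice embedding into $\mathbf{Co}(R)$ that preserves the existing bounds, and such that, furthermore, if $L$ is finite, then $R$ is finite with $$|R|\leq 2|\mathrm{J}(L)|^2-5|\mathrm{J}(L)|+4.$$
   Context: For a poset $\langle P,\trianglelefteq\rangle$, a subset $X\subseteq P$ is order-convex if $x\trianglelefteq z\trianglelefteq y$ and $x,y\in X$ imply $z\in X$, for all $x,y,z\in P$. $\mathbf{Co}(P)$ denotes the lattice of all order-convex subsets of $P$, ordered by inclusion. $\mathrm{J}(L)$ denotes the set of all join-irreducible elements of $L$ (a join-irreducible element is nonzero by convention). An embedding of $L$ into $\mathbf{Co}(R)$ preserves the existing bounds if it sends the least element of $L$ (if it exists) to $\varnothing$ and the greatest element of $L$ (if it exists) to $R$. The lattice identities (S), (U), (B) are the following. (S), in the variables $a,b,b_0,b_1,c$: $$a\wedge(b'\vee c)=(a\wedge b')\vee\bigvee_{i<2}\Bigl(a\wedge(b_i\vee c)\wedge\bigl((b'\wedge(a\vee b_i))\vee c\bigr)\Bigr),\quad\text{where } b'=b\wedge(b_0\vee b_1).$$ (U), in the variables $x,x_0,x_1,x_2$: $$x\wedge(x_0\vee x_1)\wedge(x_1\vee x_2)\wedge(x_0\vee x_2)=(x\wedge x_0\wedge(x_1\vee x_2))\vee(x\wedge x_1\wedge(x_0\vee x_2))\vee(x\wedge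 x_2\wedge(x_0\vee x_1)).$$ (B), in the variables $x,a_0,a_1,b_0,b_1$: $$x\wedge(a_0\vee a_1)\wedge(b_0\vee b_1)=\bigvee_{i<2}\Bigl(\bigl(x\wedge a_i\wedge(b_0\vee b_1)\bigr)\vee\bigl(x\wedge b_i\wedge(a_0\vee a_1)\bigr)\Bigr)\vee\bigvee_{i<2}\bigl(x\wedge(a_0\vee a_1)\wedge(b_0\vee b_1)\wedge(a_0\vee b_i)\wedge(a_1\vee b_{1-i})\bigr).$$ *)

(* Defs.v *)
From HB Require Import structures.
From mathcomp Require Import all_boot all_order all_algebra finmap.
From mathcomp Require Import boolp classical_sets functions cardinality.

Set Implicit Arguments.
Unset Strict Implicit.
Unset Printing Implicit Defensive.

Local Open Scope classical_set_scope.
Local Open Scope order_scope.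

Section OrderConvex.
Context {d : Order.disp_t} (P : porderType d).
Implicit Types (X Y : set P).

Definition order_convex X : Prop :=
  forall x y z : P, X x -> X y -> x <= z -> z <= y -> X z.

Definition convex_hull X : set P :=
  [set z | exists x y, [/\ X x, X y, x <= z & z <= y]].

Lemma order_convexI X Y :
  order_convex X -> order_convex Y -> order_convex (X `&` Y)%classic.
Proof.
move=> cX cY x y z [Xx Yx] [Xy Yy] xz zy.
by split; [apply: (cX x y) | apply: (cY x y)].
Qed.

Lemma order_convex_hull X : order_convex (convex_hull X).
Proof.
move=> x y z [a [_ [Xa _ ax _]]] [_ [b [_ Xb _ yb]]] xz zy.
by exists a, b; split=> //; [apply: Order.le_trans xz | apply: Order.le_trans yb].
Qed.

Lemma sub_convex_hull X : (X `<=` convex_hull X)%classic.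
Proof. by move=> x Xx; exists x, x. Qed.

Lemma convex_hull_sub X Y :
  order_convex Y -> (X `<=` Y)%classic -> (convex_hull X `<=` Y)%classic.
Proof. by move=> cY XY z [x [y [/XY Yx /XY Yy xz zy]]]; apply: cY xz zy. Qed.

(* The subtype machinery needs a boolean predicate, hence `[< _ >]. *)
Record Co : predArgType :=
  MkCo { co_set :> set P; co_setP : `[< order_convex co_set >] }.

HB.instance Definition _ := [isSub for co_set].
HB.instance Definition _ := [Choice of Co by <:].
HB.instance Definition _ :=
  [SubChoice_isSubPOrder of Co by <: with set_display].

Lemma Co_convex (A : Co) : order_convex A.
Proof. by apply/asboolP; apply: co_setP. Qed.

Definition co_meet (A B : Co) : Co :=
  MkCo (introT (asboolP _) (order_convexI (@Co_convex A) (@Co_convex B))).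

Definition co_join (A B : Co) : Co :=
  MkCo (introT (asboolP _) (@order_convex_hull (A `|` B)%classic)).

Lemma co_leP (A B : Co) : reflect (A `<=` B)%classic (A <= B).
Proof. exact: subsetPset. Qed.

Lemma co_meetP (A B C : Co) : (A <= co_meet B C) = (A <= B) && (A <= C).
Proof.
apply/co_leP/andP => [|[/co_leP AB /co_leP AC]]; rewrite /= subsetI; last by [].
by move=> [AB AC]; split; apply/co_leP.
Qed.

Lemma co_joinP (A B C : Co) : (co_join A B <= C) = (A <= C) && (B <= C).
Proof.
apply/co_leP/andP => [ABC|[/co_leP AC /co_leP BC]].
  have := subset_trans (@sub_convex_hull (A `|` B)%classic) ABC.
  rewrite subUset => -[AC BC].
  by split; apply/co_leP.
by apply: convex_hull_sub; [apply: Co_convex | rewrite subUset].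
Qed.

HB.instance Definition _ :=
  Order.POrder_MeetJoin_isLattice.Build set_display Co co_meetP co_joinP.

End OrderConvex.

Section LatticeNotions.
Context {d : Order.disp_t} (L : latticeType d).

Definition least (o : L) : Prop := forall x : L, o <= x.
Definition greatest (i : L) : Prop := forall x : L, x <= i.

Definition joinirr : set L :=
  [set p | ~ least p /\ forall x y : L, p = x `|` y -> p = x \/ p = y].

(* The joins over i < 2 are written out: L need not have a least element, so
   it has no indexed joins. *)
Definition identityS : Prop :=
  forall a b b0 b1 c : L,
    let b' := b `&` (b0 `|` b1) in
    let s bi := a `&` (bi `|` c) `&` ((b' `&` (a `|` bi)) `|` c) in
    a `&` (b' `|` c) = (a `&` b') `|` (s b0 `|` s b1).

Definition identityU : Prop :=
  forall x x0 x1 x2 : L,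
    x `&` (x0 `|` x1) `&` (x1 `|` x2) `&` (x0 `|` x2) =
    (x `&` x0 `&` (x1 `|` x2)) `|` (x `&` x1 `&` (x0 `|` x2))
      `|` (x `&` x2 `&` (x0 `|` x1)).

Definition identityB : Prop :=
  forall x a0 a1 b0 b1 : L,
    let s ai bi := (x `&` ai `&` (b0 `|` b1)) `|` (x `&` bi `&` (a0 `|` a1)) in
    let t bi bj := x `&` (a0 `|` a1) `&` (b0 `|` b1)
                     `&` (a0 `|` bi) `&` (a1 `|` bj) in
    x `&` (a0 `|` a1) `&` (b0 `|` b1) =
    (s a0 b0 `|` s a1 b1) `|` (t b0 b1 `|` t b1 b0).

Definition preserves_bounds {d' : Order.disp_t} (R : porderType d')
    (f : L -> Co R) : Prop :=
  (forall o : L, least o -> co_set (f o) = set0) /\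
  (forall i : L, greatest i -> co_set (f i) = [set: R]).

End LatticeNotions.

Arguments joinirr {d} L : rename.

(* Number of elements of a finite set; 0 on infinite sets. *)
Definition ncard {T : choiceType} (A : set T) : nat := size (fset_set A).

(* Main.v *)
Require Import Defs.
From HB Require Import structures.
From Stdlib Require Import Relation_Operators Operators_Properties.
From mathcomp Require Import all_boot all_order all_algebra finmap.
From mathcomp Require Import zify.
From mathcomp Require Import boolp classical_sets functions cardinality.

(* Work in the lattice of filters of L ordered by reverse inclusion, which by
   Zorn's lemma has enough join-irreducibles and minimal join-covers. Say P D Q
   if P <= Q \/ Z for some Z that does not work for any smaller Q.
   By (U) and (B), the relation P <= X \/ Y on {X | P D X} is complete
   bipartite: in a representation, the two classes lie on the two sides of P. By
   (S), if P D Q, then one of the two classes of Q lies beyond Q as seen from P.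
   The poset R has a node for each join-irreducible P, labelled P, and, for each
   pair P D Q, two nodes labelled Q, one for each of the two ways of laying out
   the classes of Q below and above. From a node labelled P, one step leads in
   the appropriate direction to a node labelled Q whenever P D Q. A track of
   steps in one direction is convex for the labels, because each node lies
   beyond the previous one, and the first label of a nontrivial track is not
   below its last one; this gives the order and makes x |-> {z | label z <= x}
   an embedding. When L is finite with n join-irreducibles, |R| is n plus twice
   the number of pairs P D Q; if there is such a pair, two tracks in opposite
   directions end with two distinct labels that are D-related to nothing, so
   there are at most (n-2)(n-1) pairs. *)

Set Implicit Arguments.
Unset Strict Implicit.
Unset Printing Implicit Defensive.

Import Order.TTheory GRing.Theory.
Local Open Scope classical_set_scope.
Local Open Scope order_scope.

(** * Reduction of (S), (U) and (B) to one inequality each *)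

Local Ltac lattice_le := first
  [ exact: lexx
  | rewrite leUx; apply/andP; split; lattice_le
  | rewrite lexI; apply/andP; split; lattice_le
  | apply: (le_trans (leIl _ _)); lattice_le
  | apply: (le_trans (leIr _ _)); lattice_le
  | apply: (le_trans _ (leUl _ _)); lattice_le
  | apply: (le_trans _ (leUr _ _)); lattice_le ].

Section IdentitiesLe.
Context {d : Order.disp_t} {L : latticeType d}.

Lemma identityS_le : (forall a b b0 b1 c : L,
    let b' := b `&` (b0 `|` b1) in
    let s bi := a `&` (bi `|` c) `&` ((b' `&` (a `|` bi)) `|` c) in
    is_true (a `&` (b' `|` c) <= (a `&` b') `|` (s b0 `|` s b1))) ->
  identityS L.
Proof.
move=> le a b b0 b1 c b' s; apply/le_anti/andP; split; first exact: le.
by rewrite /s; clearbody b'; lattice_le.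
Qed.

Lemma identityU_le : (forall x x0 x1 x2 : L,
    x `&` (x0 `|` x1) `&` (x1 `|` x2) `&` (x0 `|` x2) <=
    (x `&` x0 `&` (x1 `|` x2)) `|` (x `&` x1 `&` (x0 `|` x2))
      `|` (x `&` x2 `&` (x0 `|` x1))) -> identityU L.
Proof.
by move=> le x x0 x1 x2; apply/le_anti/andP; split; [exact: le|lattice_le].
Qed.

Lemma identityB_le : (forall x a0 a1 b0 b1 : L,
    let s ai bi := (x `&` ai `&` (b0 `|` b1)) `|` (x `&` bi `&` (a0 `|` a1)) in
    let t bi bj := x `&` (a0 `|` a1) `&` (b0 `|` b1)
                     `&` (a0 `|` bi) `&` (a1 `|` bj) in
    is_true (x `&` (a0 `|` a1) `&` (b0 `|` b1) <=
      (s a0 b0 `|` s a1 b1) `|` (t b0 b1 `|` t b1 b0))) -> identityB L.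
Proof.
by move=> le x a0 a1 b0 b1 s t; apply/le_anti/andP; split;
  [exact: le|rewrite /s /t; lattice_le].
Qed.

End IdentitiesLe.

(** * The identities in lattices of order-convex sets *)

Section CoIdentities.
Context {d : Order.disp_t} {P : porderType d}.
Implicit Types (A B : Co P) (x y z : P).

Definition below A z : Prop := exists2 x, co_set A x & x <= z.
Definition above A z : Prop := exists2 y, co_set A y & z <= y.

Lemma in_co A z : co_set A z <-> below A z /\ above A z.
Proof.
split=> [Az|[[x Ax xz] [y Ay zy]]]; first by split; exists z.
exact: (Co_convex Ax Ay).
Qed.

(** Down-closure and up-closure commute with unions. Membership in a join thus becomes propositional
    in [below] and [above], and [tauto] can finish (U) and (B). *)
Lemma in_co_join A B z : co_set (A `|` B) z <->
  (below A z \/ below B z) /\ (above A z \/ above B z).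
Proof.
split=> [[x [y [ABx ABy xz zy]]]|].
  split; [case: ABx|case: ABy]; by [left; exists x|right; exists x|
    left; exists y|right; exists y].
case=> [[[x Ax xz]|[x Bx xz]] [[y Ay zy]|[y By zy]]]; exists x, y; split=> //;
  by [left|right].
Qed.

Lemma co_joinl A B z : co_set A z -> co_set (A `|` B) z.
Proof. by move=> /in_co[? ?]; apply/in_co_join; split; left. Qed.

Lemma co_joinr A B z : co_set B z -> co_set (A `|` B) z.
Proof. by move=> /in_co[? ?]; apply/in_co_join; split; right. Qed.

Lemma co_join_between A B x y z : co_set A x -> co_set B y ->
  x <= z <= y \/ y <= z <= x -> co_set (A `|` B) z.
Proof.
move=> Ax By [] /andP[? ?]; apply/in_co_join; split;
  by [left; exists x|right; exists y].
Qed.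

Lemma co_join_cases A B z : co_set (A `|` B) z ->
  [\/ co_set A z, co_set B z | exists x y,
    [/\ co_set A x, co_set B y & x <= z <= y \/ y <= z <= x]].
Proof.
move=> [x [y [[Ax|Bx] [Ay|By] xz zy]]].
- by constructor 1; apply: (Co_convex Ax Ay).
- by constructor 3; exists x, y; split=> //; left; rewrite xz.
- by constructor 3; exists y, x; split=> //; right; rewrite xz.
- by constructor 2; apply: (Co_convex Bx By).
Qed.

Lemma Co_identityS : identityS (Co P).
Proof.
apply: identityS_le => a b b0 b1 c b' s; apply/co_leP => z [az].
have strict u w : co_set b' u -> co_set c w -> u <= z <= w \/ w <= z <= u ->
    co_set (a `&` b' `|` (s b0 `|` s b1)) z.
  move=> b'u cw uzw; have [bu] := b'u.
  have s_in bi : co_set (a `|` bi) u -> co_set (bi `|` c) z -> co_set (s bi) z.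
    move=> abu bcz; split; first by split.
    by apply: (co_join_between (x := u) (y := w)).
  have b_in bi : co_set bi u -> co_set (s bi) z.
    move=> biu; apply: s_in; first exact: co_joinr.
    by apply: (co_join_between (x := u) (y := w)).
  (* Here [v] lies beyond [u] as seen from [z], and [w] on the other side of [z]: so [u] is between
     [z] and [v], and [z] is between [v] and [w]. *)
  have b_beyond bi v : co_set bi v ->
      v <= u <= z /\ z <= w \/ z <= u <= v /\ w <= z -> co_set (s bi) z.
    move=> biv vuz; apply: s_in.
      apply: (co_join_between az biv).
      by case: vuz => -[-> _]; [right|left].
    apply: (co_join_between biv cw).
    case: vuz => -[/andP[x y] zw]; [left|right]; rewrite zw ?andbT /=;
      by [apply: le_trans y|apply: le_trans y _].
  have beyond v v' : v <= u <= v' ->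
      v <= u <= z /\ z <= w \/ z <= u <= v' /\ w <= z.
    by case: uzw => /andP[-> ->] /andP[-> ->]; [left|right].
  case/co_join_cases => [/b_in b0z|/b_in b1z|[v [v' [b0v b1v' vuv']]]].
  - by apply/co_joinr/co_joinl.
  - by apply/co_joinr/co_joinr.
  case: vuv' => /beyond[] h.
  - by apply/co_joinr/co_joinl/(b_beyond _ v) => //; left.
  - by apply/co_joinr/co_joinr/(b_beyond _ v') => //; right.
  - by apply/co_joinr/co_joinr/(b_beyond _ v') => //; left.
  - by apply/co_joinr/co_joinl/(b_beyond _ v) => //; right.
case/co_join_cases => [b'z|cz|[u [w [b'u cw uzw]]]].
- by apply: co_joinl.
- by apply/co_joinr/co_joinl; split; [split=> //|]; apply: co_joinr.
- exact: (strict u w).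
Qed.

(** If [z] is in no [xi], each [xi] misses one side of [z]; two of them miss the same side, so their
    join omits [z]. *)
Lemma Co_identityU : identityU (Co P).
Proof.
apply: identityU_le => x x0 x1 x2; apply/co_leP => z [[[xz z01] z12] z02].
have [x0z|x0z] := pselect (co_set x0 z).
  by do 2 apply: co_joinl; split.
have [x1z|x1z] := pselect (co_set x1 z).
  by apply/co_joinl/co_joinr; split.
have [x2z|x2z] := pselect (co_set x2 z).
  by apply/co_joinr; split.
move: x0z x1z x2z z01 z12 z02; rewrite !in_co_join !in_co; tauto.
Qed.

(** If [z] is in none of the four sets, one [ai] meets only the lower side of [z] and the other only
    the upper side, and likewise for the [bi]; pairing opposite sides gives a [t] term. *)
Lemma Co_identityB : identityB (Co P).
Proof.
apply: identityB_le => x a0 a1 b0 b1 s t; apply/co_leP => z [[xz za] zb].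
have [a0z|a0z] := pselect (co_set a0 z).
  by do 3 apply: co_joinl; split.
have [b0z|b0z] := pselect (co_set b0 z).
  by do 2 apply: co_joinl; apply: co_joinr; split.
have [a1z|a1z] := pselect (co_set a1 z).
  by apply/co_joinl/co_joinr/co_joinl; split.
have [b1z|b1z] := pselect (co_set b1 z).
  by apply/co_joinl/co_joinr/co_joinr; split.
have [[z00 z11]|[z01 z10]] :
    (co_set (a0 `|` b0) z /\ co_set (a1 `|` b1) z) \/
    (co_set (a0 `|` b1) z /\ co_set (a1 `|` b0) z).
- move: a0z a1z b0z b1z za zb; rewrite !in_co_join !in_co; tauto.
- by apply/co_joinr/co_joinl; do !split.
- by apply/co_joinr/co_joinr; do !split.
Qed.

End CoIdentities.

Lemma Co_sub_identities {d : Order.disp_t} (L : latticeType d)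
    {d' : Order.disp_t} (P : porderType d') (f : {lmorphism L -> Co P}) :
  injective f -> identityS L /\ identityU L /\ identityB L.
Proof.
have fI x y : f (x `&` y) = f x `&` f y by apply: omorphI.
have fU x y : f (x `|` y) = f x `|` f y by apply: omorphU.
move=> f_inj; split; [|split].
- move=> a b b0 b1 c b' s; apply: f_inj; rewrite /s /b' !(fI, fU).
  exact: (Co_identityS (f a) (f b) (f b0) (f b1) (f c)).
- move=> x x0 x1 x2; apply: f_inj; rewrite !(fI, fU).
  exact: (Co_identityU (f x) (f x0) (f x1) (f x2)).
- move=> x a0 a1 b0 b1 s t; apply: f_inj; rewrite /s /t !(fI, fU).
  exact: (Co_identityB (f x) (f a0) (f a1) (f b0) (f b1)).
Qed.

(** * Embedding a lattice by a family of filters indexed by a poset *)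

Section Representation.
Context {d d' : Order.disp_t} {L : latticeType d} {R : porderType d'}.
Variable e : R -> set L.
Hypotheses
  (eI : forall z x y, e z (x `&` y) <-> e z x /\ e z y)
  (e_ex : forall z, exists x, e z x)
  (e_proper : forall z, exists x, ~ e z x)
  (e_between : forall u z v, u <= z <= v -> (e u `&` e v `<=` e z)%classic)
  (e_split : forall z x y, e z (x `|` y) -> e z x \/ e z y \/
    exists u v, u <= z <= v /\ (e u x /\ e v y \/ e u y /\ e v x))
  (e_separate : forall x y, ~ x <= y -> exists2 z, e z x & ~ e z y).

Let e_up z x y : x <= y -> e z x -> e z y.
Proof. by move=> /meet_idPl xE; rewrite -xE => /eI[]. Qed.

Lemma spectrum_convex x : `[< order_convex [set z | e z x] >].
Proof.
apply/asboolP => u v z ux vx uz zv; apply: (e_between (u := u) (v := v)) => //.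
by rewrite uz.
Qed.

Definition spectrum x : Co R := MkCo (spectrum_convex x).

Lemma spectrum_homo : {homo spectrum : x y / x <= y}.
Proof. by move=> x y xy; apply/co_leP => z; apply: e_up. Qed.

Lemma spectrumI : {morph spectrum : x y / x `&` y}.
Proof.
move=> x y; apply/val_inj/seteqP; split=> z.
  by move/eI.
by move=> ?; apply/eI.
Qed.

Lemma spectrumU : {morph spectrum : x y / x `|` y}.
Proof.
move=> x y; apply/le_anti/andP; split; last first.
  by rewrite leUx !spectrum_homo ?leUl ?leUr.
apply/co_leP => z /e_split[|[]].
- by move=> zx; apply: co_joinl.
- by move=> zy; apply: co_joinr.
move=> [u [v [uzv]]] [[ux vy]|[uy vx]].
  by apply: (@co_join_between _ _ (spectrum x) (spectrum y) u v); [| |left].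
by apply: (@co_join_between _ _ (spectrum x) (spectrum y) v u); [| |right].
Qed.

Lemma spectrum_inj : injective spectrum.
Proof.
have sub x y : spectrum x = spectrum y -> x <= y.
  move=> xy; apply: contrapT => /e_separate[z zx]; apply.
  by have : co_set (spectrum y) z by rewrite -xy.
by move=> x y xy; apply/le_anti/andP; split; apply: sub.
Qed.

HB.instance Definition _ :=
  Order.isOrderMorphism.Build d L set_display (Co R) spectrum spectrum_homo.
HB.instance Definition _ :=
  Order.isLatticeMorphism.Build d L set_display (Co R) spectrum
    spectrumI spectrumU.

Lemma Co_embedding : exists f : {lmorphism L -> Co R},
  injective f /\ preserves_bounds f.
Proof.
exists spectrum; split; first exact: spectrum_inj.
split=> [o o_least|i i_greatest]; apply/seteqP; split=> z //.
- move=> zo; have [x] := e_proper z; apply.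
  exact: e_up (o_least x) zo.
- by move=> _; have [x zx] := e_ex z; apply: e_up (i_greatest x) zx.
Qed.

End Representation.

(** * Filters, maximal filters and join-irreducible filters *)

Section Filters.
Context {d : Order.disp_t} {L : latticeType d}.
Implicit Types (F N P Q X Y Z : set L).

Record lfilter F : Prop := LFilter {
  lfilter_ex : exists x, F x;
  lfilterI : forall x y, F x -> F y -> F (x `&` y);
  lfilter_up : forall x y, x <= y -> F x -> F y }.

Definition adjoin F v : set L := [set y | exists2 x, F x & x `&` v <= y].

Lemma adjoin_filter F v : lfilter F -> lfilter (adjoin F v).
Proof.
move=> fF; have [x Fx] := lfilter_ex fF; split; first by exists (x `&` v), x.
- move=> y z [a Fa ay] [c Fc cz]; exists (a `&` c); first exact: lfilterI.
  rewrite lexI (le_trans _ ay) ?(le_trans _ cz) //.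
    by apply: leI2; rewrite ?leIr.
  by apply: leI2; rewrite ?leIl.
- by move=> y z yz [a Fa ay]; exists a => //; apply: le_trans yz.
Qed.

Lemma sub_adjoin F v : (F `<=` adjoin F v)%classic.
Proof. by move=> x Fx; exists x => //; apply: leIl. Qed.

Lemma mem_adjoin F v : lfilter F -> adjoin F v v.
Proof. by move=> /lfilter_ex[x Fx]; exists x => //; apply: leIr. Qed.

(** Maximality among the filters disjoint from [N], in elementwise form: adjoining any [v] outside
    [F] produces an element of [N]. *)
Definition maxfilter N F : Prop :=
  [/\ lfilter F, (forall x, F x -> ~ N x) &
      forall v, ~ F v -> exists x n, [/\ F x, N n & x `&` v <= n]].

Lemma maxfilter_exists N F : lfilter F -> (forall x, F x -> ~ N x) ->
  exists2 X, maxfilter N X & (F `<=` X)%classic.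
Proof.
move=> fF FN.
(* Taking the union with [F] makes the empty chain harmless in Zorn's lemma. *)
pose good A := lfilter (A `|` F)%classic /\
  forall x, (A `|` F)%classic x -> ~ N x.
have [A [[fA AN] Amax]] : exists A, good A /\
    forall B, (A `<` B)%classic -> ~ good B.
  apply: Zorn_bigcup => C CP Ctot; split; last first.
    move=> x [[A CA Ax]|/FN//]; have [_ +] := CP A CA.
    by apply; left.
  have [x Fx] := lfilter_ex fF.
  split; first by exists x; right.
  - move=> {Fx}x y [[A CA Ax]|Fx] [[B CB By]|Fy].
    + have [AB|BA] := Ctot A B CA CB.
      * have [[_ + _] _] := CP B CB => /(_ x y).
        by case; [left; exact: AB|left|left; exists B|right].
      * have [[_ + _] _] := CP A CA => /(_ x y).
        by case; [left|left; exact: BA|left; exists A|right].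
    + have [[_ + _] _] := CP A CA => /(_ x y).
      by case; [left|right|left; exists A|right].
    + have [[_ + _] _] := CP B CB => /(_ x y).
      by case; [right|left|left; exists B|right].
    + by right; apply: lfilterI.
  - move=> {Fx}x y xy [[A CA Ax]|Fx]; last by right; apply: lfilter_up xy Fx.
    have [[_ _ +] _] := CP A CA => /(_ x y xy).
    by case; [left|left; exists A|right].
exists (A `|` F)%classic; last by move=> x; right.
split=> // v Av; apply: contrapT => noxn.
pose B := adjoin (A `|` F)%classic v.
have AB : (A `|` F `<=` B)%classic by apply: sub_adjoin.
have BF : (B `|` F)%classic = B by apply/setUidPl => x Fx; apply: AB; right.
apply: (Amax B); rewrite ?/good ?BF.
  split=> [x Ax|BA]; first by apply: AB; left.
  by apply: Av; left; apply: BA; apply: mem_adjoin.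
split; first exact: adjoin_filter.
by move=> y [x Ax xvy] Ny; apply: noxn; exists x, y.
Qed.

Definition principal (a : L) : set L := [set x | a <= x].

Lemma principal_filter a : lfilter (principal a).
Proof.
split; first by exists a; apply: lexx.
- by move=> x y ax ay; rewrite /principal /= lexI; apply/andP.
- by move=> x y xy ax; apply: le_trans xy.
Qed.

(* In the lattice of filters under reverse inclusion, [cov P X Y] reads
   P <= X \/ Y, and [~ (X `<=` P)] reads ~ P <= X. *)
Definition cov P X Y : Prop := forall z, X z -> Y z -> P z.

Lemma covC P X Y : cov P X Y -> cov P Y X.
Proof. by move=> c z Yz Xz; apply: c. Qed.

(* Elementwise form of join-irreducibility of P in the lattice of filters. *)
Definition jirr P : Prop :=
  [/\ lfilter P, (exists x, ~ P x) &
      forall f g, ~ P f -> ~ P g ->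
        exists2 q, P q & ~ P ((q `&` f) `|` (q `&` g))].

Lemma jirr_filter P : jirr P -> lfilter P. Proof. by case. Qed.

(** Join-irreducibility iterated over a list. It transfers identities from L to [P]: once [q] is met
    into the first variable, every joinand on the right lies below [r], while the left side is in
    [P]. *)
Lemma jirr_seq P (s : seq L) : jirr P -> (forall f, f \in s -> ~ P f) ->
  exists q r, [/\ P q, ~ P r & all (fun f => q `&` f <= r) s].
Proof.
move=> [fP [x0 Px0] jP]; elim: s => [|f s IH] sP.
  by have [q Pq] := lfilter_ex fP; exists q, x0.
have [|q [r [Pq Pr sr]]] := IH.
  by move=> g gs; apply: sP; rewrite inE gs orbT.
have [|q' Pq' Pr'] := jP f r _ Pr; first by apply: sP; rewrite mem_head.
exists (q `&` q'), ((q' `&` f) `|` (q' `&` r)); split=> //=.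
  exact: lfilterI.
apply/andP; split.
  by rewrite (le_trans _ (leUl _ _)) // leI2 // leIr.
apply/allP=> g /(allP sr) qg; rewrite (le_trans _ (leUr _ _)) // lexI.
apply/andP; split; first by rewrite (le_trans (leIl _ _)) ?leIr.
by rewrite (le_trans _ qg) // leI2 // leIl.
Qed.

Lemma nsub_ex X P : ~ (X `<=` P)%classic -> exists2 x, X x & ~ P x.
Proof. by move=> /nonsubset[x [Xx Px]]; exists x. Qed.

Lemma leI3 (x y z : L) :
  [/\ x `&` y `&` z <= x, x `&` y `&` z <= y & x `&` y `&` z <= z].
Proof. by split; rewrite ?leIr // leIx2 // ?leIl ?leIr ?orbT. Qed.

(** * Join-covers of join-irreducible filters under (S), (U) and (B) *)

Section Identities.
Hypotheses (S : identityS L) (U : identityU L) (B : identityB L).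

Lemma cov_join P X Y x y : lfilter X -> lfilter Y -> cov P X Y ->
  X x -> Y y -> P (x `|` y).
Proof.
move=> fX fY XY Xx Yy; apply: XY.
  by apply: lfilter_up Xx => //; apply: leUl.
by apply: lfilter_up Yy => //; apply: leUr.
Qed.

Lemma jirr_U P X Y Z : jirr P -> lfilter X -> lfilter Y -> lfilter Z ->
  cov P X Y -> cov P Y Z -> cov P X Z ->
  (X `<=` P \/ Y `<=` P \/ Z `<=` P)%classic.
Proof.
move=> jP fX fY fZ XY YZ XZ; apply: contrapT => /not_orP[+ /not_orP[]].
have fP := jirr_filter jP.
move=> /nsub_ex[x Xx Px] /nsub_ex[y Yy Py] /nsub_ex[z Zz Pz].
have [f|q [r [Pq Pr /and4P[qx qy qz _]]]] := @jirr_seq P [:: x; y; z] jP.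
  by rewrite !inE => /or3P[] /eqP->.
apply: Pr; have := U q x y z; set l := (X in X = _) => lE.
suff : P l.
  apply: lfilter_up => //; rewrite lE !leUx -andbA.
  by apply/and3P; split; apply: le_trans (leIl _ _) _.
rewrite /l; do !apply: lfilterI => //.
- exact: cov_join fX fY XY Xx Yy.
- exact: cov_join fY fZ YZ Yy Zz.
- exact: cov_join fX fZ XZ Xx Zz.
Qed.

Lemma jirr_B P X Y X' Y' : jirr P ->
  lfilter X -> lfilter Y -> lfilter X' -> lfilter Y' ->
  ~ (X `<=` P)%classic -> ~ (Y `<=` P)%classic ->
  ~ (X' `<=` P)%classic -> ~ (Y' `<=` P)%classic ->
  cov P X Y -> cov P X' Y' ->
  cov P X X' /\ cov P Y Y' \/ cov P X Y' /\ cov P Y X'.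
Proof.
move=> jP fX fY fX' fY' /nsub_ex[x Xx Px] /nsub_ex[y Yy Py].
move=> /nsub_ex[x' Xx' Px'] /nsub_ex[y' Yy' Py'] XY XY'.
have fP := jirr_filter jP.
have P_down u v : u <= v -> ~ P v -> ~ P u.
  by move=> uv Pv Pu; apply: Pv; apply: lfilter_up Pu.
(* A failing disjunct provides a join bounded outside P. *)
have witness A A' C C' : lfilter A -> lfilter A' -> lfilter C -> lfilter C' ->
    ~ (cov P A A' /\ cov P C C') -> exists a a' c c' f,
    [/\ A a /\ A' a', C c /\ C' c', ~ P f & (a `|` a') `&` (c `|` c') <= f].
  move=> fA fA' fC fC' /not_andP[] /existsNP[f] /not_implyP[Af].
    move=> /not_implyP[A'f Pf].
    have [c Cc] := lfilter_ex fC; have [c' Cc'] := lfilter_ex fC'.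
    by exists f, f, c, c', f; split=> //; rewrite joinxx leIl.
  move=> /not_implyP[A'f Pf].
  have [c Cc] := lfilter_ex fA; have [c' Cc'] := lfilter_ex fA'.
  by exists c, c', f, f, f; split=> //; rewrite joinxx leIr.
apply: contrapT => /not_orP[].
move=> /witness[] // a [a' [b [b' [f [[Xa Xa'] [Yb Yb'] Pf abf]]]]].
move=> /witness[] // c [c' [e [e' [g [[Xc Xc'] [Ye Ye'] Pg ceg]]]]].
(* Each variable is taken below an element outside [P] and below the witnesses of both failures, so
   that all six joinands of (B) are bounded outside [P]. *)
pose a0 := x `&` a `&` c; pose a1 := y `&` b `&` e.
pose b0 := x' `&` a' `&` e'; pose b1 := y' `&` b' `&` c'.
have Xa0 : X a0 by do !apply: lfilterI.
have Ya1 : Y a1 by do !apply: lfilterI.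
have Xb0 : X' b0 by do !apply: lfilterI.
have Yb1 : Y' b1 by do !apply: lfilterI.
have [a0x a0a a0c] := leI3 x a c; have [a1y a1b a1e] := leI3 y b e.
have [b0x b0a b0e] := leI3 x' a' e'; have [b1y b1b b1c] := leI3 y' b' c'.
have [h|q [r [Pq Pr]]] := @jirr_seq P [:: a0; a1; b0; b1; f; g] jP.
  rewrite !inE => /or4P[/eqP->|/eqP->|/eqP->|/or3P[] /eqP->] //;
  [exact: P_down _ _ a0x Px|exact: P_down _ _ a1y Py|
   exact: P_down _ _ b0x Px'|exact: P_down _ _ b1y Py'].
move=> /= /and4P[qa0 qa1 qb0 /and4P[qb1 qf qg _]].
apply: Pr; have := B q a0 a1 b0 b1 => /=; set l := (X in X = _) => lE.
suff : P l.
  apply: lfilter_up => //; rewrite lE !leUx.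
  rewrite (le_trans (leIl _ _) qa0) (le_trans (leIl _ _) qa1).
  rewrite (le_trans (leIl _ _) qb0) (le_trans (leIl _ _) qb1) /=.
  rewrite -!(meetA (q `&` _ `&` _)).
  apply/andP; split.
    apply: le_trans qf; apply: leI2; first by rewrite -meetA leIl.
    by apply: le_trans abf; apply: leI2; apply: leU2.
  apply: le_trans qg; apply: leI2; first by rewrite -meetA leIl.
  by apply: le_trans ceg; apply: leI2; apply: leU2.
rewrite /l; do !apply: lfilterI => //.
  exact: cov_join fX fY XY Xa0 Ya1.
exact: cov_join fX' fY' XY' Xb0 Yb1.
Qed.

(* Q is a minimal nontrivial cofactor: P <= Q \/ Z but P </= Q' \/ Z for
   every filter Q' < Q. *)
Definition mincov P Q Z : Prop :=
  [/\ lfilter Z, ~ (Z `<=` P)%classic, ~ (Q `<=` P)%classic &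
      maxfilter (Z `\` P)%classic Q].

Lemma mincov_cov P Q Z : mincov P Q Z -> cov P Q Z.
Proof.
move=> [_ _ _ [_ QN _]] z Qz Zz; apply: contrapT => Pz.
exact: QN Qz (conj Zz Pz).
Qed.

(* The join-dependency relation. *)
Definition depD P Q : Prop := exists Z, mincov P Q Z.

Definition cofactor P Q Z : Prop :=
  [/\ lfilter Z, ~ (Z `<=` P)%classic & cov P Q Z].

Lemma depD_filter P Q : depD P Q -> lfilter Q.
Proof. by case=> Z [_ _ _ []]. Qed.

Lemma depD_nsub P Q : depD P Q -> ~ (Q `<=` P)%classic.
Proof. by case=> Z []. Qed.

Lemma mincov_sub P Q Q' Z : mincov P Q Z -> lfilter Q' ->
  (Q `<=` Q')%classic -> cov P Q' Z -> (Q' `<=` Q)%classic.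
Proof.
move=> [_ _ _ [_ QN Qmax]] fQ' QQ' Q'Z x Q'x; apply: contrapT => /Qmax.
move=> [y [n [Qy [Zn Pn] yxn]]]; apply: Pn; apply: Q'Z => //.
by apply: lfilter_up yxn _ => //; apply: lfilterI => //; apply: QQ'.
Qed.

Lemma cov_refine P X Y : lfilter X -> lfilter Y -> cov P X Y ->
  ~ (X `<=` P)%classic -> ~ (Y `<=` P)%classic -> exists Q R,
  [/\ (X `<=` Q)%classic, (Y `<=` R)%classic, mincov P Q R & mincov P R Q].
Proof.
move=> fX fY XY XP YP.
have [x Xx|Q Qmax XQ] := @maxfilter_exists (Y `\` P)%classic X fX.
  by case=> Yx; apply; apply: XY.
have [fQ QN Qm] := Qmax.
have QP : ~ (Q `<=` P)%classic by move=> QP; apply: XP => x /XQ /QP.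
have [y Yy|R Rmax YR] := @maxfilter_exists (Q `\` P)%classic Y fY.
  by case=> Qy Py; apply: QN Qy (conj Yy Py).
have [fR RN _] := Rmax.
have RP : ~ (R `<=` P)%classic by move=> RP; apply: YP => y /YR /RP.
exists Q, R; split=> //.
split=> //; split=> //.
  by move=> x Qx [Rx Px]; apply: RN Rx (conj Qx Px).
move=> v /Qm[x [n [Qx [Yn Pn] xvn]]]; exists x, n; split=> //.
by split=> //; apply: YR.
Qed.

Lemma depD_partner P Q : depD P Q -> exists2 R, depD P R & cov P Q R.
Proof.
move=> [Z mZ]; have [fZ ZP QP [fQ QN Qmax]] := mZ.
have [z Zz|R Rmax ZR] := @maxfilter_exists (Q `\` P)%classic Z fZ.
  by case=> Qz; apply; apply: mincov_cov mZ _ _ _.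
have [fR RN _] := Rmax.
exists R; last first.
  move=> z Qz Rz; apply: contrapT => Pz; exact: RN Rz (conj Qz Pz).
by exists Q; split=> // RP; apply: ZP => z /ZR /RP.
Qed.

(* Dual 2-distributivity: it follows from U applied to the pairwise joins. *)
Lemma jirr_D2 P X Y Z : jirr P -> lfilter X -> lfilter Y -> lfilter Z ->
  (forall x, X x -> Y x -> Z x -> P x) -> cov P X Y \/ cov P Y Z \/ cov P X Z.
Proof.
move=> jP fX fY fZ XYZ.
have fI A C : lfilter A -> lfilter C -> lfilter (A `&` C)%classic.
  move=> fA fC; have [a Aa] := lfilter_ex fA; have [c Cc] := lfilter_ex fC.
  split; first by exists (a `|` c); split;
    [apply: lfilter_up Aa|apply: lfilter_up Cc] => //; rewrite ?leUl ?leUr.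
  - by move=> x y [Ax Cx] [Ay Cy]; split; apply: lfilterI.
  - by move=> x y xy [Ax Cx]; split; apply: lfilter_up xy _.
have [] := @jirr_U P (X `&` Y)%classic (Y `&` Z)%classic (X `&` Z)%classic jP.
all: try exact: fI.
- by move=> x [Xx Yx] [_ Zx]; apply: XYZ.
- by move=> x [Yx Zx] [Xx _]; apply: XYZ.
- by move=> x [Xx Yx] [_ Zx]; apply: XYZ.
- by move=> h; left=> x Xx Yx; apply: h.
case=> h; right; [left=> x Yx Zx|right=> x Xx Zx]; exact: h.
Qed.

(** If Q were the join of two smaller filters, [jirr_D2] would put P below the join of those two,
    hence below Q, or below the join of one of them with Z, against the minimality of Q. *)
Lemma depD_jirr P Q : jirr P -> depD P Q -> jirr Q.
Proof.
move=> jP [Z mZ]; have [fZ ZP QP [fQ QN Qmax]] := mZ.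
split=> //.
  have [z Zz Pz] := nsub_ex ZP; exists z => Qz; apply: Pz.
  exact: mincov_cov mZ _ Qz Zz.
move=> f g Qf Qg.
apply: contrapT => H.
have {}H q : Q q -> Q ((q `&` f) `|` (q `&` g)).
  by move=> Qq; apply: contrapT => Qr; apply: H; exists q.
have adjoin_cov v : ~ Q v -> ~ cov P (adjoin Q v) Z.
  move=> Qv vZ; apply: Qv; apply: (mincov_sub mZ (adjoin_filter v fQ)) => //.
    exact: sub_adjoin.
  exact: mem_adjoin.
have adjoinI : cov Q (adjoin Q f) (adjoin Q g).
  move=> y [a Qa ay] [c Qc cy].
  apply: lfilter_up (H _ (lfilterI fQ Qa Qc)) => //.
  rewrite leUx (le_trans _ ay) ?(le_trans _ cy) //.
    by apply: leI2; rewrite ?leIr.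
  by apply: leI2; rewrite ?leIl.
have [||||fg|[gZ|fZ']] := @jirr_D2 P (adjoin Q f) (adjoin Q g) Z jP => //;
  try exact: adjoin_filter.
- by move=> x fx gx Zx; apply: mincov_cov mZ _ (adjoinI _ fx gx) Zx.
- by apply: QP => x Qx; apply: fg; apply: sub_adjoin.
- exact: adjoin_cov Qg gZ.
- exact: adjoin_cov Qf fZ'.
Qed.

(** Minimality of Q does not depend on the cofactor. If Q' < Q still works with Z, (B) applied to Q,
    W and Q', Z gives P <= Q \/ Q' = Q or P <= W \/ Q', both impossible. *)
Lemma depD_mincov P Q Z : jirr P -> depD P Q -> cofactor P Q Z -> mincov P Q Z.
Proof.
move=> jP DQ [fZ ZP QZ]; have [W mW] := DQ; have [fW WP QP [fQ QN Qmax]] := mW.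
split=> //; split=> //; first by move=> x Qx [Zx]; apply; apply: QZ.
move=> v Qv; apply: contrapT => noxn.
pose Q' := adjoin Q v; have fQ' : lfilter Q' by apply: adjoin_filter.
have QQ' : (Q `<=` Q')%classic by apply: sub_adjoin.
have Q'Z : cov P Q' Z.
  move=> y [x Qx xvy] Zy; apply: contrapT => Py.
  by apply: noxn; exists x, y.
have Q'P : ~ (Q' `<=` P)%classic by move=> Q'P; apply: QP => x /QQ' /Q'P.
have [[QQ'P _]|[_ WQ']] :=
  jirr_B jP fQ fW fQ' fZ QP WP Q'P ZP (mincov_cov mW) Q'Z.
  by apply: QP => x Qx; apply: QQ'P => //; apply: QQ'.
by apply: Qv; apply: (mincov_sub mW fQ' QQ' (covC WQ')); apply: mem_adjoin.
Qed.

Lemma jirr_S P Q Z Y0 Y1 : jirr P -> mincov P Q Z ->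
  lfilter Y0 -> lfilter Y1 -> cov Q Y0 Y1 ->
  cov P Y0 Z /\ cov Q P Y0 \/ cov P Y1 Z /\ cov Q P Y1.
Proof.
move=> jP mZ fY0 fY1 Y01; have [fZ ZP QP [fQ QN Qmax]] := mZ.
have fP := jirr_filter jP.
have P_down u v : u <= v -> ~ P v -> ~ P u.
  by move=> uv Pv Pu; apply: Pv; apply: lfilter_up Pu.
have [b Qb Pb] := nsub_ex QP.
(* A failing disjunct bounds the corresponding joinand of S outside P. *)
have witness Y : lfilter Y -> ~ (cov P Y Z /\ cov Q P Y) -> exists p q z y f,
    [/\ P p /\ Q q, Z z /\ Y y, ~ P f & forall a b' bi c,
        a <= p -> b' <= q -> bi <= y -> c <= z ->
        (bi `|` c) `&` ((b' `&` (a `|` bi)) `|` c) <= f].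
  move=> fY /not_andP[] /existsNP[f] /not_implyP[].
    move=> Yf /not_implyP[Zf Pf].
    have [p Pp] := lfilter_ex fP; have [q Qq] := lfilter_ex fQ.
    exists p, q, f, f, f; split=> // a b' bi c _ _ bif cf.
    by rewrite leIx2 // leUx bif cf.
  (* Maximality of [Q] converts [f] outside [Q] into a bound [n] in [Z] outside [P]. *)
  move=> Pf /not_implyP[Yf Qf]; have [x [n [Qx [Zn Pn] xvn]]] := Qmax f Qf.
  exists f, x, n, f, n; split=> // a b' bi c af b'x bif cn.
  rewrite leIx2 //; apply/orP; right; rewrite leUx cn andbT.
  by apply: le_trans xvn; apply: leI2 => //; rewrite leUx af bif.
apply: contrapT => /not_orP[].
move=> /(witness _ fY0)[p0 [q0 [z0 [y0 [f0 [[Pp0 Qq0] [Zz0 Yy0] Pf0 h0]]]]]].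
move=> /(witness _ fY1)[p1 [q1 [z1 [y1 [f1 [[Pp1 Qq1] [Zz1 Yy1] Pf1 h1]]]]]].
pose b' := (b `&` q0 `&` q1) `&` (y0 `|` y1).
have Qb' : Q b'.
  apply: lfilterI => //; first by do !apply: lfilterI.
  exact: cov_join fY0 fY1 Y01 Yy0 Yy1.
have [b'b b'q0 b'q1] : [/\ b' <= b, b' <= q0 & b' <= q1].
  by have [] := leI3 b q0 q1; split; apply: le_trans (leIl _ _) _.
have [|q [r [Pq Pr /and4P[qb qf0 qf1 _]]]] := @jirr_seq P [:: b; f0; f1] jP.
  by move=> h; rewrite !inE => /or3P[] /eqP->.
pose a := q `&` p0 `&` p1; pose c := z0 `&` z1.
have [aq ap0 ap1] := leI3 q p0 p1; rewrite -/a in aq ap0 ap1.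
apply: Pr; have := S a (b `&` q0 `&` q1) y0 y1 c => /=.
rewrite -/b'; set l := (X in X = _) => lE.
suff : P l.
  apply: lfilter_up => //; rewrite lE !leUx.
  rewrite -(meetA a (y0 `|` c)) -(meetA a (y1 `|` c)).
  apply/and3P; split.
  - by apply: le_trans qb; apply: leI2.
  - by apply: le_trans qf0; apply: leI2 => //; apply: h0; rewrite // leIl.
  - by apply: le_trans qf1; apply: leI2 => //; apply: h1; rewrite // leIr.
rewrite /l; apply: (lfilterI fP); first by do !apply: (lfilterI fP).
exact: cov_join fQ fZ (mincov_cov mZ) Qb' (lfilterI fZ Zz0 Zz1).
Qed.

(** * The two classes of D-related filters *)

Lemma jirr_no_triangle P X Y Z : jirr P ->
  lfilter X -> lfilter Y -> lfilter Z ->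
  ~ (X `<=` P)%classic -> ~ (Y `<=` P)%classic -> ~ (Z `<=` P)%classic ->
  cov P X Y -> cov P Y Z -> ~ cov P X Z.
Proof.
move=> jP fX fY fZ XP YP ZP XY YZ XZ.
by have [//|[//|//]] := jirr_U jP fX fY fZ XY YZ XZ.
Qed.

(** Given neighbours X' of X and Y' of Y, (B) makes X adjacent to Y or to Y'. In the latter case X
    and Y both differ in colour from Y', so they have the same colour. *)
Lemma cov_complete_bipartite P (f : set L -> bool) : jirr P ->
  (forall X Y, depD P X -> depD P Y -> cov P X Y -> f X != f Y) ->
  forall X Y, depD P X -> depD P Y -> (cov P X Y <-> f X != f Y).
Proof.
move=> jP fcov X Y DX DY; split=> [|fXY]; first exact: fcov.
have [X' DX' XX'] := depD_partner DX; have [Y' DY' YY'] := depD_partner DY.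
have [[//]|[XY' _]] := jirr_B jP (depD_filter DX) (depD_filter DX')
  (depD_filter DY) (depD_filter DY') (depD_nsub DX) (depD_nsub DX')
  (depD_nsub DY) (depD_nsub DY') XX' YY'.
have := fcov _ _ DX DY' XY'; have := fcov _ _ DY DY' YY'.
by move: fXY; case: (f X) (f Y) (f Y') => [] [] [].
Qed.

(* In a convex representation, the X with [far P Q X] lie on the other side of
   Q as seen from P. *)
Definition far P Q X : Prop := exists2 Z, cofactor P Q Z & cov Q X Z.

Section Far.
Variables (P Q : set L).
Hypotheses (jP : jirr P) (DQ : depD P Q).

Let jQ : jirr Q. Proof. exact: depD_jirr jP DQ. Qed.
Let fP : lfilter P. Proof. exact: jirr_filter. Qed.

Lemma cofactor_nsub Z : cofactor P Q Z -> ~ (Z `<=` Q)%classic.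
Proof.
by move=> [_ ZP QZ] ZQ; apply: ZP => z Zz; apply: QZ => //; apply: ZQ.
Qed.

Lemma far_or X Y Z : depD Q X -> depD Q Y -> cov Q X Y -> cofactor P Q Z ->
  [/\ cov P X Z, cov Q P X & cov Q X Z] \/
  [/\ cov P Y Z, cov Q P Y & cov Q Y Z].
Proof.
move=> DX DY XY cZ; have [[XZ PX]|[YZ PY]] :=
  jirr_S jP (depD_mincov jP DQ cZ) (depD_filter DX) (depD_filter DY) XY.
  by left; split=> // z Xz Zz; apply: PX => //; apply: XZ.
by right; split=> // z Yz Zz; apply: PY => //; apply: YZ.
Qed.

Lemma cov_cofactor_excl X Y Z : depD Q X -> depD Q Y -> cov Q X Y ->
  cofactor P Q Z -> cov Q X Z -> ~ cov Q Y Z.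
Proof.
move=> DX DY XY cZ XZ YZ; have ZQ := cofactor_nsub cZ; have [fZ _ _] := cZ.
exact: (jirr_no_triangle jQ (depD_filter DX) (depD_filter DY) fZ
  (depD_nsub DX) (depD_nsub DY) ZQ XY YZ XZ).
Qed.

Lemma far_cov X : depD Q X -> far P Q X -> cov Q P X.
Proof.
move=> DX [Z cZ XZ]; have [Y DY XY] := depD_partner DX.
by have [[]//|[_ _]] := far_or DX DY XY cZ;
  move/(cov_cofactor_excl DX DY XY cZ XZ).
Qed.

(** Being far is independent of the cofactor. If Z favoured the neighbour Y while W favours X, then
    P, X, Y would be a triangle at Q unless Q <= P. In that case (B) at P yields the triangle Q, W,
    Z or P <= X \/ Z, hence Q <= X \/ Z. *)
Lemma far_cofactor X Z : depD Q X -> far P Q X -> cofactor P Q Z -> cov Q X Z.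
Proof.
move=> DX [W cW XW] cZ; have [Y DY XY] := depD_partner DX.
have [[]//|[YZ PY QYZ]] := far_or DX DY XY cZ.
have [[XW' PX _]|[_ _ YW]] := far_or DX DY XY cW; last first.
  by have := cov_cofactor_excl DX DY XY cW XW YW.
have [fX fY] := (depD_filter DX, depD_filter DY).
have [fZ ZP QZ] := cZ; have [fW WP QW] := cW; have fQ := depD_filter DQ.
have [PQ|PQ] := pselect (P `<=` Q)%classic; last first.
  have := jirr_no_triangle jQ fX fY fP (depD_nsub DX) (depD_nsub DY) PQ XY.
  by move=> /(_ (covC PY))[]; apply: covC.
have XP : ~ (X `<=` P)%classic.
  by move=> XP; apply: (depD_nsub DX) => x /XP /PQ.
have YP : ~ (Y `<=` P)%classic.
  by move=> YP; apply: (depD_nsub DY) => x /YP /PQ.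
have [[_ WZ]|[XZ _]] := jirr_B jP fX fW fY fZ XP WP YP ZP XW' YZ.
  have := jirr_no_triangle jP fQ fW fZ (depD_nsub DQ) WP ZP QW WZ.
  by move/(_ QZ).
by move=> x Xx Zx; apply: PQ; apply: XZ.
Qed.

Lemma far_split X Y : depD Q X -> depD Q Y -> cov Q X Y ->
  `[< far P Q X >] != `[< far P Q Y >].
Proof.
move=> DX DY XY; have [Z [fZ ZP QP mQ]] := DQ.
have cZ : cofactor P Q Z by split=> //; apply: mincov_cov.
case: asboolP => fX; case: asboolP => fY //=.
  have := cov_cofactor_excl DX DY XY cZ.
  by move=> /(_ (far_cofactor DX fX cZ))[]; apply: far_cofactor.
by have [[_ _ XZ]|[_ _ YZ]] := far_or DX DY XY cZ;
  [case: fX|case: fY]; exists Z.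
Qed.

End Far.

(* An arbitrary member of {X | P D X}, used to orient its two classes. *)
Definition root P : set L := xget set0 (depD P).

(** Both adjacent to the root would be a triangle; if neither is, compare the edge X, Y with an edge
    at the root by (B). *)
Lemma root_split P X Y : jirr P -> depD P X -> depD P Y -> cov P X Y ->
  `[< cov P X (root P) >] != `[< cov P Y (root P) >].
Proof.
move=> jP DX DY XY; have DR : depD P (root P) by apply: xgetI DX.
have [[fX fY] fR] := (depD_filter DX, depD_filter DY, depD_filter DR).
have [[nX nY] nR] := (depD_nsub DX, depD_nsub DY, depD_nsub DR).
case: (asboolP (cov P X _)) => XR; case: (asboolP (cov P Y _)) => YR //=.
  by have := jirr_no_triangle jP fX fY fR nX nY nR XY YR XR.
have [R' DR' RR'] := depD_partner DR.
by have [[/XR//]|[_ /YR//]] := jirr_B jP fX fY fR (depD_filter DR') nX nY nR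
  (depD_nsub DR') XY RR'.
Qed.

(** * Nodes, labels and steps *)

Definition pre_node : Type := (set L + set L * set L * bool)%type.

Definition node_ok (z : pre_node) : Prop :=
  match z with
  | inl P => jirr P
  | inr (P, Q, _) => jirr P /\ depD P Q
  end.

Definition node : Type := {z : pre_node | `[< node_ok z >]}.
HB.instance Definition _ := Choice.copy node {z : pre_node | `[< node_ok z >]}.

Implicit Types (z w u v : node) (s : bool).

Definition Node p (ok : node_ok p) : node :=
  exist (fun p => `[< node_ok p >]) p (introT (asboolP _) ok).

Lemma nodeP z : node_ok (val z). Proof. exact/asboolP/(valP z). Qed.

Definition label z : set L :=
  match val z with inl P => P | inr (_, Q, _) => Q end.

(* The direction, seen from the node z, in which a copy of X is placed; (P,Q,s)
   is a copy of Q that has P in direction ~~ s. *)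
Definition direction z X : bool :=
  match val z with
  | inl P => `[< cov P X (root P) >]
  | inr (P, Q, s) => if `[< far P Q X >] then s else ~~ s
  end.

Lemma label_jirr z : jirr (label z).
Proof.
by have := nodeP z; rewrite /label; case: (val z) => [P|[[P Q] s]] //= [];
  apply: depD_jirr.
Qed.

Lemma direction_cov z X Y : depD (label z) X -> depD (label z) Y ->
  (cov (label z) X Y <-> direction z X != direction z Y).
Proof.
move: X Y; apply: cov_complete_bipartite; first exact: label_jirr.
have := nodeP z; rewrite /label /direction; case: (val z) => [P|[[P Q] s]] /=.
  by move=> jP X Y; apply: root_split.
move=> [jP DQ] X Y DX DY /(far_split jP DQ DX DY).
by case: `[< _ >]; case: `[< _ >]; case: s.
Qed.

(** The target remembers only the label of [z], not the track leading to it. Different nodes may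
    share a successor, which keeps the poset small. *)
Definition step s z w : Prop :=
  exists X,
    [/\ depD (label z) X, direction z X = s & val w = inr (label z, X, s)].

Lemma step_exists z X : depD (label z) X ->
  exists2 w, step (direction z X) z w & label w = X.
Proof.
move=> DX; have ok : node_ok (inr (label z, X, direction z X)).
  by split=> //; apply: label_jirr.
by exists (Node ok) => //; exists X.
Qed.

Lemma step_val s z w : step s z w -> val w = inr (label z, label w, s).
Proof. by case=> X [_ _ wE]; rewrite /label wE. Qed.

Lemma step_depD s z w : step s z w -> depD (label z) (label w).
Proof. by case=> X [DX _ wE]; rewrite {2}/label wE. Qed.

Lemma step_direction s z w : step s z w -> direction z (label w) = s.
Proof. by case=> X [_ <- wE]; rewrite /label wE. Qed.

Lemma step_far s z w u : step s z w -> step s w u ->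
  far (label z) (label w) (label u).
Proof.
move=> zw wu; have := step_direction wu.
by rewrite /direction (step_val zw); case: asboolP => //; case: s zw wu.
Qed.

(** * Convexity of labels along tracks *)

Definition reach s : node -> node -> Prop := clos_refl_trans_1n node (step s).

Lemma reach_step s z w u : step s z w -> reach s w u -> reach s z u.
Proof. by move=> zw wu; apply: Relation_Operators.rt1n_trans zw wu. Qed.

Lemma reach_refl s z : reach s z z.
Proof. exact: rt1n_refl. Qed.

Lemma reach_trans s z w u : reach s z w -> reach s w u -> reach s z u.
Proof.
move=> zw wu; apply: clos_rt_rt1n.
by apply: (rt_trans _ _ _ w); apply: clos_rt1n_rt.
Qed.

Lemma reach_last s z w : reach s z w ->
  z = w \/ exists2 u, reach s z u & step s u w.
Proof.
move=> /(clos_rt1n_rt _ _ _ _)/(clos_rt_rtn1 _ _ _ _)[|u v uv zu].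
  by left.
by right; exists u => //; apply: clos_rt_rt1n; apply: clos_rtn1_rt.
Qed.

(** By [far_cofactor], Z is again a cofactor for the next step, from w to w'. Induction gives w' <=
    u \/ Z, and w <= w' \/ Z. *)
Lemma reach_cofactor s z w u Z : step s z w -> reach s w u ->
  cofactor (label z) (label w) Z -> cov (label w) (label u) Z.
Proof.
move=> zw wu; elim: wu z zw => {w u} [w z zw _ x //|w w' u ww' w'u IH z zw cZ].
have DQ := step_depD zw; have DX := step_depD ww'.
have w'Z : cov (label w) (label w') Z.
  exact: (far_cofactor (label_jirr z) DQ DX (step_far zw ww') cZ).
have [fZ _ _] := cZ; have ZQ := cofactor_nsub cZ.
by move=> x ux Zx; apply: (w'Z x (IH _ ww' (And3 fZ ZQ w'Z) x ux Zx) Zx).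
Qed.

Lemma reach_between1 s z w u : step s z w -> reach s w u ->
  cov (label w) (label u) (label z).
Proof.
move=> zw wu; case: wu zw => [_ x //|w' u' ww' w'u' zw].
have DQ := step_depD zw; have DX := step_depD ww'.
have [zw_sub|zw_nsub] := pselect (label z `<=` label w)%classic.
  by move=> x _; apply: zw_sub.
have w'z : cov (label w) (label w') (label z).
  apply: covC; apply: (far_cov (label_jirr z) DQ DX); exact: step_far zw ww'.
have cz : cofactor (label w) (label w') (label z).
  by split=> //; apply/jirr_filter/label_jirr.
move=> x ux zx; apply: w'z => //; exact: (reach_cofactor ww' w'u' cz).
Qed.

Lemma reach_between s z w u : reach s z w -> reach s w u ->
  cov (label w) (label u) (label z).
Proof.
elim=> {z w} [z _ x //|z z' w zz' z'w IH wu] x ux zx.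
by apply: IH => //; apply: (reach_between1 zz' (reach_trans z'w wu)).
Qed.

(** If z <= u, the node v just before u would satisfy v <= u \/ z = u, although v D u. *)
Lemma reach_nsub s z w u : step s z w -> reach s w u ->
  ~ (label u `<=` label z)%classic.
Proof.
move=> zw wu uz; have [wE|[v wv vu]] := reach_last wu.
  by apply: (depD_nsub (step_depD zw)); rewrite wE.
apply: (depD_nsub (step_depD vu)) => x ux.
have zv : reach s z v by apply: reach_step zw wv.
exact: (reach_between zv (reach_step vu (reach_refl _ _)) ux (uz _ ux)).
Qed.

Lemma reach_anti s z w : reach s z w -> reach s w z -> z = w.
Proof.
by case=> // u {}w zu uw wz; case: (reach_nsub zu (reach_trans uw wz)).
Qed.

(** The first steps enter opposite classes, which cover z; [reach_cofactor] then replaces each first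
    label by the end of its track. *)
Lemma reach_two_sided s z u v : reach s z u -> reach (~~ s) z v ->
  cov (label z) (label u) (label v).
Proof.
case=> [_ x //|u1 {}u zu1 u1u]; case=> [x _ //|v1 {}v zv1 v1v].
have [Du Dv] := (step_depD zu1, step_depD zv1).
have uv1 : cov (label z) (label u1) (label v1).
  apply/direction_cov => //.
  by rewrite (step_direction zu1) (step_direction zv1); case: (s).
have fl w : lfilter (label w) by apply/jirr_filter/label_jirr.
have cv1 : cofactor (label z) (label u1) (label v1).
  by split=> //; apply: depD_nsub.
have cu : cofactor (label z) (label v1) (label u).
  split=> //; first exact: reach_nsub zu1 u1u.
  move=> x v1x ux; apply: uv1 => //.
  exact: reach_cofactor zu1 u1u cv1 _ ux v1x.
move=> x ux vx; have [_ _ c] := cu; apply: c => //.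
exact: reach_cofactor zv1 v1v cu _ vx ux.
Qed.

(** * The order on nodes and the embedding *)

Definition node_le u v : Prop := exists2 z, reach false z u & reach true z v.

(** A node stores the direction in which it is entered, so tracks of opposite directions meet only
    at the origin of one of them. Transitivity and antisymmetry rest on this. *)
Lemma reach_opp s z z' v : reach s z v -> reach (~~ s) z' v -> v = z \/ v = z'.
Proof.
move=> /reach_last[->|[u _ /step_val uv]]; first by left.
move=> /reach_last[->|[u' _ /step_val]]; first by right.
by rewrite uv => -[_]; case: (s).
Qed.

Lemma node_le_refl z : node_le z z.
Proof. by exists z; apply: reach_refl. Qed.

Lemma node_le_trans u v w : node_le u v -> node_le v w -> node_le u w.
Proof.
move=> [z zu zv] [z' z'v z'w]; have [vE|vE] := reach_opp zv z'v; subst v.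
  by exists z' => //; apply: reach_trans zu.
by exists z => //; apply: reach_trans z'w.
Qed.

Lemma node_le_anti u v : node_le u v -> node_le v u -> u = v.
Proof.
move=> [z zu zv] [z' z'v z'u].
have [uE|uE] := reach_opp z'u zu; have [vE|vE] := reach_opp zv z'v.
- by subst u v; apply: reach_anti z'v zu.
- by rewrite uE vE.
- by rewrite uE vE.
- by subst u v; apply: reach_anti zv z'u.
Qed.

(** By [reach_opp], w is one of the two origins. If w = z, it lies on a track from z' to u, so w <=
    u \/ z', while z' <= u \/ v; the other case is symmetric. *)
Lemma label_between u v w : node_le u w -> node_le w v ->
  cov (label w) (label u) (label v).
Proof.
move=> [z zu zw] [z' z'w z'v] x ux vx.
have [wE|wE] := reach_opp zw z'w; subst w.
  apply: (reach_between z'w zu ux).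
  by apply: (reach_two_sided (reach_trans z'w zu) z'v ux vx).
apply: (reach_between zw z'v vx).
by apply: (reach_two_sided zu (reach_trans zw z'v) ux vx).
Qed.

Lemma node_split z x y : label z (x `|` y) -> ~ label z x -> ~ label z y ->
  exists u v, [/\ node_le u z, node_le z v &
    label u x /\ label v y \/ label u y /\ label v x].
Proof.
move=> zxy zx zy; have up := lfilter_up (jirr_filter (label_jirr z)).
have [|||||X [Y [xX yY mX mY]]] :=
  @cov_refine (label z) (principal x) (principal y).
all: try exact: principal_filter.
- by move=> t xt yt; apply: up zxy; rewrite leUx; apply/andP.
- by move=> /(_ x (lexx x)).
- by move=> /(_ y (lexx y)).
have DX : depD (label z) X by exists Y.
have DY : depD (label z) Y by exists X.
have [u zu uE] := step_exists DX; have [v zv vE] := step_exists DY.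
have ux : label u x by rewrite uE; apply/xX/lexx.
have vy : label v y by rewrite vE; apply/yY/lexx.
have [+ _] := direction_cov DX DY => /(_ (mincov_cov mX)).
move: (reach_step zu (reach_refl _ _)) (reach_step zv (reach_refl _ _)).
case: (direction z X) (direction z Y) => [] [] // ru rv _.
  exists v, u; split; last (by right);
    by exists z => //; apply: reach_refl.
exists u, v; split; last (by left);
  by exists z => //; apply: reach_refl.
Qed.

(** A filter containing [a] and maximal for omitting [b] is join-irreducible: anything outside it
    can be cut below [b]. *)
Lemma node_separate a b : ~ a <= b -> exists2 z, label z a & ~ label z b.
Proof.
move=> ab; have [|P [fP Pb Pmax] aP] :=
    @maxfilter_exists [set b] (principal a) (principal_filter a).
  by move=> x ax xb; apply: ab; rewrite -xb.
have jP : jirr P.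
  split=> //; first by exists b => Pb'; apply: Pb Pb' _.
  move=> f g /Pmax[x [_ [Px -> xf]]] /Pmax[y [_ [Py -> yg]]].
  exists (x `&` y); first exact: lfilterI.
  move=> Pr; apply: (Pb b _ erefl); apply: (lfilter_up fP _ Pr).
  rewrite leUx (le_trans _ xf) ?(le_trans _ yg) //.
    by apply: leI2; rewrite ?leIr.
  by apply: leI2; rewrite ?leIl.
have ok : node_ok (inl P) by [].
exists (Node ok); first exact: aP (lexx a).
by move=> /Pb; apply.
Qed.

Definition node_leb : rel node := fun u v => `[< node_le u v >].

Lemma node_leb_refl : reflexive node_leb.
Proof. by move=> z; apply/asboolP/node_le_refl. Qed.

Lemma node_leb_anti : antisymmetric node_leb.
Proof. by move=> u v /andP[/asboolP uv /asboolP vu]; apply: node_le_anti. Qed.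

Lemma node_leb_trans : transitive node_leb.
Proof.
by move=> v u w /asboolP uv /asboolP vw; apply/asboolP; apply: node_le_trans vw.
Qed.

HB.instance Definition _ := Order.Le_isPOrder.Build (Order.Disp tt tt) node
  node_leb_refl node_leb_anti node_leb_trans.

Lemma node_embedding : exists f : {lmorphism L -> Co node},
  injective f /\ preserves_bounds f.
Proof.
apply: (@Co_embedding _ _ L node label).
- move=> z x y; have fz := jirr_filter (label_jirr z).
  split=> [zxy|[]]; last exact: lfilterI.
  by split; apply: lfilter_up zxy; rewrite ?leIl ?leIr.
- by move=> z; apply/lfilter_ex/jirr_filter/label_jirr.
- by move=> z; have [] := label_jirr z.
- move=> u z v /andP[/asboolP uz /asboolP zv] x [ux vx].
  exact: (label_between uz zv ux vx).
- move=> z x y zxy.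
  have [zx|zx] := pselect (label z x); first by left.
  have [zy|zy] := pselect (label z y); first by right; left.
  have [u [v [uz zv uv]]] := node_split zxy zx zy.
  by right; right; exists u, v; split=> //; apply/andP; split; apply/asboolP.
- exact: node_separate.
Qed.

(** * Finite lattices: counting the nodes *)

Lemma step_toward s z X : depD (label z) X -> exists w, step s z w.
Proof.
move=> DX; have [Y DY XY] := depD_partner DX.
have [w zw _] := step_exists DX; have [w' zw' _] := step_exists DY.
have [+ _] := direction_cov DX DY => /(_ XY).
move: zw zw'; case: (direction z X) (direction z Y) s => [] [] [] // zw zw' _;
  by [exists w|exists w'].
Qed.

(** Each step strictly shrinks the set of reachable codes: by [reach_nsub], [z] cannot be reached
    again. *)
Lemma track_end (K : finType) (c : node -> K) s z : injective c ->
  exists2 w, reach s z w & forall X, ~ depD (label w) X.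
Proof.
move=> c_inj; pose rset w : pred K :=
  [pred k | `[< exists2 v, reach s w v & c v = k >]].
have [n] := ubnP #|rset z|; elim: n z => // n IH z zn.
have [[X DX]|noX] := pselect (exists X, depD (label z) X); last first.
  by exists z; [apply: reach_refl|move=> X DX; apply: noX; exists X].
have [w zw] := step_toward s DX.
have [|v wv vend] := IH w; last by exists v => //; apply: reach_step wv.
rewrite -ltnS (leq_trans _ zn) // ltnS; apply/proper_card/properP; split.
  apply/fintype.subsetP => k; rewrite !inE => -[v wv <-].
  by exists v => //; apply: reach_step wv.
exists (c z); rewrite inE; first by exists z => //; apply: reach_refl.
by apply/asboolP => -[v wv /c_inj vz]; apply: (reach_nsub zw wv); rewrite vz.
Qed.

(** Equal end labels would give z <= u by [reach_two_sided], against [reach_nsub]. *)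
Lemma two_track_ends (K : finType) (c : node -> K) z X : injective c ->
  depD (label z) X -> exists u v, [/\ label u <> label v,
    forall Y, ~ depD (label u) Y & forall Y, ~ depD (label v) Y].
Proof.
move=> c_inj DX; have [u' zu'] := step_toward true DX.
have [v' zv'] := step_toward false DX.
have [u u'u uend] := track_end true u' c_inj.
have [v v'v vend] := track_end false v' c_inj.
exists u, v; split=> // uv; apply: (reach_nsub zu' u'u) => x ux.
apply: (reach_two_sided (reach_step zu' u'u) (reach_step zv' v'v) ux).
by rewrite -uv.
Qed.

Section Finite.
Hypothesis finL : finite_set [set: L]%classic.

Lemma jirr_principal P : jirr P -> exists2 p, joinirr L p & P = principal p.
Proof.
move=> [fP [x Px] jP].
have [s sL] := (finite_seqP _).1 finL.
have [p Pp ps] : exists2 p, P p & forall y, y \in s -> P y -> p <= y.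
  elim: s {sL} => [|y s [p Pp ps]].
    by have [p Pp] := lfilter_ex fP; exists p.
  have [Py|Py] := pselect (P y); last first.
    by exists p => // z; rewrite inE => /predU1P[->//|]; apply: ps.
  exists (p `&` y); first exact: lfilterI.
  move=> z; rewrite inE => /predU1P[->|zs] Pz; first exact: leIr.
  by apply: le_trans (leIl _ _) _; apply: ps.
have pP y : P y -> p <= y.
  by apply: ps; have : [set: L]%classic y by []; rewrite sL.
have PE : P = principal p.
  by apply/seteqP; split=> y; [apply: pP|move=> py; apply: lfilter_up Pp].
exists p => //; split=> [p_least|y z pE].
  by apply: Px; apply: (lfilter_up fP (p_least x) Pp).
apply: contrapT => /not_orP[py pz].
have yp : y <= p by rewrite pE leUl.
have zp : z <= p by rewrite pE leUr.
have Py : ~ P y by move=> /pP py'; apply: py; apply/le_anti; rewrite py'.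
have Pz : ~ P z by move=> /pP pz'; apply: pz; apply/le_anti; rewrite pz'.
have [q /pP pq] := jP _ _ Py Pz; apply.
by rewrite (meet_idPr (le_trans yp pq)) (meet_idPr (le_trans zp pq)) -pE.
Qed.

Local Notation J := (fset_sub_type (fset_set (joinirr L))).

Lemma finite_joinirr : finite_set (joinirr L).
Proof. by apply: sub_finite_set finL. Qed.

Lemma node_card (z0 : node) : finite_set [set: node]%classic /\
  (let n := ncard (joinirr L) in
   ncard [set: node]%classic <= n + (n - 2) * (n - 1) * 2)%N.
Proof.
have cardJ : ncard (joinirr L) = #|J| by rewrite -cardfE.
rewrite /= cardJ.
have genJ P : jirr P -> exists j : J, P = principal (val j).
  move=> /jirr_principal[p pJ ->]; have pJ' : p \in fset_set (joinirr L).
    by rewrite in_fset_set ?inE //; apply: finite_joinirr.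
  by exists [` pJ']%fset.
have [j0 _] := genJ _ (label_jirr z0).
have /boolp.choice[g gP] P : exists j : J, jirr P -> P = principal (val j).
  by have [/genJ[j jP]|jP] := pselect (jirr P); [exists j|exists j0].
have g_inj P Q : jirr P -> jirr Q -> g P = g Q -> P = Q.
  by move=> /gP PE /gP QE PQ; rewrite PE QE PQ.
pose c z : J + (J * J * bool) :=
  match val z with inl P => inl (g P) | inr (P, Q, s) => inr (g P, g Q, s) end.
have c_inj : injective c.
  move=> u v; have := nodeP u; have := nodeP v; rewrite /c => vP uP uv.
  apply: val_inj.
  case: (val u) (val v) uP vP uv => [P|[[P Q] s]] [P'|[[P' Q'] s']] //=.
    by move=> jP jP' [/(g_inj _ _ jP jP')->].
  move=> [jP DQ] [jP' DQ'] [/(g_inj _ _ jP jP') PE + ->]; subst P'.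
  by move/(g_inj _ _ (depD_jirr jP DQ) (depD_jirr jP DQ'))->.
have fin : finite_set [set: node]%classic.
  have := @finite_preimage _ _ [set: J + (J * J * bool)]%classic c.
  by rewrite preimage_setT; apply; [move=> ? ? _ _ /c_inj|apply: finite_finset].
split=> //.
have bound (A : pred (J + (J * J * bool))) : (forall z, A (c z)) ->
    (ncard [set: node]%classic <= #|A|)%N.
  move=> cA; rewrite /ncard -(size_map c) cardE; apply: uniq_leq_size.
    by rewrite map_inj_uniq ?fset_uniq.
  by move=> k /mapP[z _ ->]; rewrite mem_enum; apply: cA.
have card_split (D : pred (J * J)) :
    #|[pred k : J + (J * J * bool) | if k is inr (ab, _) then D ab else true]| =
    (#|J| + #|D| * 2)%N.
  rewrite -sum1_card big_sumType /= sum1_card; congr addn.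
  transitivity (\sum_(ab | D ab) \sum_(t : bool) 1)%N.
    by rewrite pair_big; apply: eq_big => [[ab t]|//]; rewrite /= andbT.
  by rewrite sum1_card card_bool sum_nat_const.
have [[z [X DX]]|noD] := pselect (exists z X, depD (label z) X); last first.
  apply: leq_trans (leq_addr _ _).
  have := card_split pred0; rewrite card0 mul0n addn0 => <-.
  apply: bound => z /=.
  have := nodeP z; rewrite /c /=; case: (val z) => [//|[[P Q] s]] /= [jP DQ].
  have ok : node_ok (inl P) by [].
  by case: noD; exists (Node ok), Q.
have [u [v [uv uend vend]]] := two_track_ends c_inj DX.
pose E : pred J := pred2 (g (label u)) (g (label v)).
(* Pairs P D Q are among these: P is neither of the two end labels, and Q differs from P. *)
pose D : pred (J * J) := [pred ab | ~~ E ab.1 & ab.2 != ab.1].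
have cardE : #|E| = 2.
  rewrite card2; case: eqP => // guv; case: uv.
  by apply: g_inj guv; apply: label_jirr.
have cardD : #|D| = ((#|J| - 2) * (#|J| - 1))%N.
  rewrite -sum1_card.
  transitivity (\sum_(a | ~~ E a) \sum_(b | b != a) 1)%N.
    by rewrite pair_big_dep.
  rewrite (eq_bigr (fun=> (#|J| - 1)%N)) => [|a _].
    by rewrite sum_nat_const -cardE -(cardC E) addKn.
  by rewrite sum1_card cardC1 subn1.
rewrite -cardD -card_split; apply: bound => w; have := nodeP w.
rewrite /c /=; case: (val w) => [//|[[P Q] s]] /= [jP DQ].
have jQ := depD_jirr jP DQ.
rewrite /D /= /E /= negb_or -!andbA; apply/and3P; split.
- apply/eqP => /(g_inj _ _ jP (label_jirr _)) PE; apply: (uend Q); rewrite -PE.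
  exact: DQ.
- apply/eqP => /(g_inj _ _ jP (label_jirr _)) PE; apply: (vend Q); rewrite -PE.
  exact: DQ.
- apply/eqP => /(g_inj _ _ jQ jP) QE; apply: (depD_nsub DQ).
  by rewrite QE.
Qed.

End Finite.

End Identities.
End Filters.

(** For n >= 2 the two bounds coincide. Truncated subtraction makes the left one 0 for n = 0 and 1
    for n = 1, where the right one is 4 and 1. *)
Lemma joinirr_bound (m n : nat) : (m <= n + (n - 2) * (n - 1) * 2)%N ->
  (m%:Z <= 2 * n%:Z ^+ 2 - 5 * n%:Z + 4)%R.
Proof.
rewrite expr2; case: n => [|[|n]]; [lia|lia|].
by rewrite (_ : n.+2 - 2 = n)%N; [nia|lia].
Qed.

(** * Equivalence of embeddability and the identities *)

Theorem theorem6p7 (d : Order.disp_t) (L : latticeType d) :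
  [<->
    (* (i) *)
    exists (d' : Order.disp_t) (P : porderType d')
           (f : {lmorphism L -> Co P}), injective f;
    (* (ii) *)
    identityS L /\ identityU L /\ identityB L;
    (* (iii) *)
    exists (d' : Order.disp_t) (R : porderType d')
           (f : {lmorphism L -> Co R}),
      injective f /\ preserves_bounds f /\
      (finite_set [set: L]%classic ->
       finite_set [set: R]%classic /\
       let n := (ncard (joinirr L))%:Z%R in
       ((ncard [set: R]%classic)%:Z <= 2 * n ^+ 2 - 5 * n + 4)%R)].
Proof.
tfae.
- by move=> [d' [P [f f_inj]]]; exact: (Co_sub_identities f_inj).
- move=> [S [U B]]; have [f [f_inj f_bounds]] := node_embedding S U B.
  exists _, _, f; split=> //; split=> // finL /=.
  (* [node_card] takes a node to obtain a default join-irreducible; there is none when L has at most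
     one element. *)
  have [node0|/set0P[z _]] := eqVneq [set: @node d L]%classic set0.
    rewrite node0; split=> //; apply: joinirr_bound.
    by rewrite /ncard fset_set0.
  have [fin le_card] := node_card S U B finL z.
  by split=> //; apply: joinirr_bound.
- by move=> [d' [P [f [f_inj _]]]]; exists d', P, f.
Qed.
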